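(* Let $\tilde T_g\in\mathcal S(X,\mathbb R,C^\alpha_P)$, where $P$ consists of $\rho$ periodic orbits $P_0,\dots,P_{\rho-1}$, and let $u:X\setminus R_P\to\mathbb R$ be the unique uniformly bounded function with $u(Tx)=g_x(u(x))$ for all $x\in X\setminus R_P$. For each $0\le r\le\rho-1$ choose one point $p_r\in P_r$. Then there is a $\rho$-parameter family of invariant graphs $u_s:X\to\mathbb R$, $s=(s_0,\dots,s_{\rho-1})\in\mathbb R^\rho$, for the skew product: for every $s\in\mathbb R^\rho$, $u_s(Tx)=g_x(u_s(x))$ for all $x\in X$, $u_s(p_r)=s_r$ for all $0\le r\le\rho-1$, and $u_s|_{X\setminus R_P}=u$.
   Context: **Base map.** $X=\mathbb R/\mathbb Z$ is the circle with its usual metric $d$, viewed as $[0,1]$ with $0$ and $1$ identified. $T:X\to X$ is a continuous, expanding, locally eventually onto Markov map: $T$ is continuous; there are $0=t_0<t_1<\dots<t_b=1$ and $X_j=[t_j,t_{j+1}]$ such that for each $j$ the restriction of $T$ to $\mathrm{Int}\,X_j$ is a $C^1$ diffeomorphism onto its image, with derivative extending continuously to the end-points, and $T(X_j)=\bigcup_{i\in I_j}X_i$ is a union of partition intervals; there is $\theta\in(0,1)$ with $|T'(x)|\ge\theta^{-1}$ for all $x\in\bigcup_j\mathrm{Int}\,X_j$; and there is $N\in\mathbb N$ with $T^NX_j=X$ for all $j$. **Skew product.** $\tilde T_g(x,t)=(Tx,g_x(t))$ on $X\times\mathbb R$, where $g_x:\mathbb R\to\mathbb R$ is a homeomorphism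 for each $x\in X$. Write $h_x=g_x^{-1}$, $g^n_x=g_{T^{n-1}x}\circ\dots\circ g_{Tx}\circ g_x$ and $h^n_x=(g^n_x)^{-1}=h_x\circ h_{Tx}\circ\dots\circ h_{T^{n-1}x}$. $P=\bigcup_{r=0}^{\rho-1}P_r\subset X$ is a finite union of $\rho$ distinct periodic orbits of $T$; $\ell(p)$ is the least period of $p\in P$; $B_\delta(P)=\bigcup_{p\in P}B_\delta(p)$ with $B_\delta(p)$ the open ball of radius $\delta$. $R_P=\{x\in X: T^nx\in P\text{ for some }n\ge0\}$. **The class $\mathcal S(X,\mathbb R,C^\alpha_P)$.** Fix $\alpha>0$ and $C_{\mathcal S}\ge1$. $\tilde T_g\in\mathcal S(X,\mathbb R,C^\alpha_P)$ means that the following hold for some small $\epsilon>0$: (i) $g_p^{\ell(p)}(t)=t$ for all $p\in P$, $t\in\mathbb R$; (ii) $|h^n_x(t)-h^n_x(t')|\le C_{\mathcal S}|t-t'|$ for all $x\in X$, $n\in\mathbb N$, $t,t'\in\mathbb R$; (iii) there is $\lambda:[0,\epsilon]\to(0,\infty)$ with $\log\lambda$ Hölder continuous (some positive exponent) and $\lambda(0)=1$ such that, whenever $x,\dots,T^{n-1}x\in B_\epsilon(P)$ and $\epsilon_j=\inf_{p\in P}d(T^jx,p)$, $|h^n_x(t)-h^n_x(t')|\ge C_{\mathcal S}^{-1}\lambda(\epsilon_0)\cdots\lambda(\epsilon_{n-1})|t-t'|$ for all $t,t'$; (iv) for each $0<\delta\le\epsilon$ there is $\lambda_\delta\in(0,1)$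 such that, whenever the orbit segment $x,\dots,T^{n-1}x$ visits $X\setminus B_\delta(P)$ exactly $j$ times, $|h^n_x(t)-h^n_x(t')|\le C_{\mathcal S}\lambda_\delta^j|t-t'|$ for all $t,t'$; (v) $|g_x(t)-g_y(t)|\le C_g(t)d(x,y)^\alpha$ and $|h_x(t)-h_y(t)|\le C_h(t)d(x,y)^\alpha$ for all $x,y\in X$, $t\in\mathbb R$, with $C_g,C_h$ bounded on compact subsets of $\mathbb R$. It is known that for such skew products a uniformly bounded $u:X\setminus R_P\to\mathbb R$ with $u(Tx)=g_x(u(x))$ exists and is unique. *)

(* Defs.v *)
From HB Require Import structures.
From mathcomp Require Import all_boot all_order all_algebra.
From mathcomp Require Import all_classical all_reals all_analysis.
From mathcomp Require Import lra.

Set Implicit Arguments.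
Unset Strict Implicit.
Unset Printing Implicit Defensive.

Import Order.TTheory GRing.Theory Num.Theory.
Import numFieldNormedType.Exports.

Local Open Scope classical_set_scope.
Local Open Scope ring_scope.

(* The circle R/Z: each class is given by its representative in [0, 1[. *)
Record circle (R : realType) := Circle {
  crep : R;
  crepP : 0 <= crep < 1 }.

HB.instance Definition _ (R : realType) := [isSub for @crep R].
HB.instance Definition _ (R : realType) := [Choice of circle R by <:].

Section CircleMetric.
Variable R : realType.
Implicit Types x y z : circle R.

(* The arc-length distance, i.e. the minimum of |x - y + k| over integers k. *)
Definition circle_dist x y : R :=
  Num.min `|crep x - crep y| (1 - `|crep x - crep y|).

Lemma circle_distxx x : circle_dist x x = 0.
Proof. by rewrite /circle_dist subrr normr0 subr0 min_l. Qed.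

Lemma circle_dist_eq0 x y : circle_dist x y = 0 -> x = y.
Proof.
move=> xy0; apply: val_inj => /=; move: xy0.
have := crepP x; have := crepP y; rewrite /circle_dist.
by case: (ler0P (crep x - crep y)) => ?; rewrite minEle; case: ifP => ?; lra.
Qed.

Lemma circle_dist_sym x y : circle_dist x y = circle_dist y x.
Proof. by rewrite /circle_dist distrC. Qed.

Lemma circle_dist_triangle y x z :
  circle_dist x z <= circle_dist x y + circle_dist y z.
Proof.
have := crepP x; have := crepP y; have := crepP z; rewrite /circle_dist.
case: (ler0P (crep x - crep y)) => ?; case: (ler0P (crep y - crep z)) => ?;
  case: (ler0P (crep x - crep z)) => ?; rewrite !minEle;
  by do 3 (case: ifPn; rewrite -?ltNge => ?); lra.
Qed.

HB.instance Definition _ := @isMetric.Build R (circle R) circle_dist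
  circle_distxx circle_dist_eq0 circle_dist_sym circle_dist_triangle.

Lemma cproj_subproof (y : R) : 0 <= y - (Num.floor y)%:~R < 1.
Proof. by rewrite subr_ge0 floor_le /= ltrBlDr addrC -intrD1 floorD1_gt. Qed.

(* The quotient map R -> R/Z. *)
Definition cproj (y : R) : circle R := Circle (cproj_subproof y).

End CircleMetric.

Section MarkovMap.
Variable R : realType.
Implicit Types (f T : circle R -> circle R) (A : set (circle R)).

(* f'(x) = l, read off a lift F of f to R near a preimage y of x.  Any two such
   lifts, being continuous at y, differ by a constant integer near y. *)
Definition cderiv_at f (x : circle R) (l : R) : Prop :=
  exists (y : R) (F : R -> R),
    [/\ cproj y = x,
        \forall z \near y, f (cproj z) = cproj (F z) &
        is_derive y 1 F l].

Definition C1_on f A : Prop :=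
  exists D : circle R -> R,
    {within A, continuous D} /\ (forall x, A x -> cderiv_at f x (D x)).

(* The values of f and of f' outside A and f @` A are irrelevant. *)
Definition C1_diffeo_onto_image f A : Prop :=
  C1_on f A /\
  exists f' : circle R -> circle R,
    (forall x, A x -> f' (f x) = x) /\ C1_on f' (f @` A).

Definition arc (a b : R) : set (circle R) := (@cproj R) @` `[a, b].
Definition open_arc (a b : R) : set (circle R) := (@cproj R) @` `]a, b[.

(* Continuous, expanding, locally eventually onto Markov map. *)
Definition markov_map T : Prop :=
  continuous T /\
  exists (b : nat) (t : nat -> R),
    [/\ t 0%N = 0, t b = 1 & forall j, (j < b)%N -> t j < t j.+1] /\
    [/\ forall j, (j < b)%N ->
          [/\ C1_diffeo_onto_image T (open_arc (t j) (t j.+1)),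
              exists D : R -> R, {within `[t j, t j.+1], continuous D} /\
                (forall y, t j < y < t j.+1 -> cderiv_at T (cproj y) (D y)) &
              exists2 I : set nat, I `<=` [set i | (i < b)%N] &
                T @` arc (t j) (t j.+1) = \bigcup_(i in I) arc (t i) (t i.+1)],
        exists theta : R, 0 < theta < 1 /\
          (forall j, (j < b)%N -> forall x l,
            open_arc (t j) (t j.+1) x -> cderiv_at T x l ->
            theta^-1 <= `|l|) &
        exists N : nat, forall j, (j < b)%N ->
          iter N T @` arc (t j) (t j.+1) = setT].

End MarkovMap.

Section SkewProduct.
Variables (R : realType) (T : circle R -> circle R).
Implicit Types (g h : circle R -> R -> R) (x p : circle R) (P : set (circle R)).

Definition homeo_inverse (f f' : R -> R) : Prop :=
  [/\ cancel f f', cancel f' f, continuous f & continuous f'].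

(* g^n_x = g_{T^{n-1}x} \o ... \o g_x *)
Fixpoint fwd_cocycle g (n : nat) x (t : R) : R :=
  if n is m.+1 then g (iter m T x) (fwd_cocycle g m x t) else t.

(* h^n_x = h_x \o ... \o h_{T^{n-1}x} *)
Fixpoint bwd_cocycle h (n : nat) x (t : R) : R :=
  if n is m.+1 then bwd_cocycle h m x (h (iter m T x) t) else t.

Definition is_least_period p (l : nat) : Prop :=
  [/\ (0 < l)%N, iter l T p = p &
      forall m, (0 < m < l)%N -> iter m T p <> p].

Definition periodic_orbit (O : set (circle R)) : Prop :=
  exists p, (exists2 l, (0 < l)%N & iter l T p = p) /\
            O = [set iter n T p | n in [set: nat]].

(* The set R_P of points whose forward orbit meets P. *)
Definition preorbit P : set (circle R) := [set x | exists n, P (iter n T x)].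

Definition ball_of_set (delta : R) P : set (circle R) :=
  \bigcup_(p in P) ball p delta.

Definition dist_to P x : R := inf [set mdist x p | p in P].

(* Number of visits of x, ..., T^{n-1} x to A. *)
Definition visits (A : set (circle R)) (n : nat) x : nat :=
  (\sum_(k < n) (iter k T x \in A))%N.

Definition holder_on (A : set R) (f : R -> R) : Prop :=
  exists beta K : R, 0 < beta /\
    (forall s t, A s -> A t -> `|f s - f t| <= K * `|s - t| `^ beta).

(* The skew product (x, t) |-> (T x, g x t) belongs to S(X, R, C^alpha_P) with
   constant C; h x is the inverse of g x. *)
Record class_S P (alpha C : R) g h : Prop := ClassS {
  class_S_homeo : forall x, homeo_inverse (g x) (h x);
  class_S_periodic : forall p l t, P p -> is_least_period p l ->
    fwd_cocycle g l p t = t;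
  class_S_lipschitz : forall x n t t',
    `|bwd_cocycle h n x t - bwd_cocycle h n x t'| <= C * `|t - t'|;
  class_S_local : exists2 eps : R, 0 < eps &
    (exists lam : R -> R,
      [/\ forall s, 0 <= s <= eps -> 0 < lam s,
          holder_on `[0, eps] (fun s => ln (lam s)),
          lam 0 = 1 &
          forall x n,
            (forall k, (k < n)%N -> ball_of_set eps P (iter k T x)) ->
            forall t t',
              C^-1 * (\prod_(k < n) lam (dist_to P (iter k T x))) * `|t - t'|
              <= `|bwd_cocycle h n x t - bwd_cocycle h n x t'|]) /\
    (forall delta, 0 < delta <= eps ->
      exists2 lam_d : R, 0 < lam_d < 1 &
        forall x n j, visits (~` ball_of_set delta P) n x = j ->
        forall t t',
          `|bwd_cocycle h n x t - bwd_cocycle h n x t'|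
          <= C * lam_d ^+ j * `|t - t'|);
  class_S_holder : exists Cg Ch : R -> R,
    [/\ forall K : set R, compact K -> bounded_set (Cg @` K),
        forall K : set R, compact K -> bounded_set (Ch @` K),
        forall x y t, `|g x t - g y t| <= Cg t * mdist x y `^ alpha &
        forall x y t, `|h x t - h y t| <= Ch t * mdist x y `^ alpha] }.

(* Invariance u (T x) = g_x (u x) over A. *)
Definition invariant_graph_on (A : set (circle R)) g (u : circle R -> R) : Prop :=
  forall x, A x -> u (T x) = g x (u x).

End SkewProduct.

(* Main.v *)
(* On the preorbit of P, declare v to be the value at x when some fibre image
   g^n_x(v) equals g^m_{p_r}(s_r) with T^n x = T^m p_r.  Fibre maps being
   bijective, such a v exists; it is unique because distinct periodic orbits are
   disjoint and the return maps g_p^l(p) are the identity, and the relation is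
   preserved by the skew product.  Off the preorbit, u_s is u. *)
Require Import Defs.
From mathcomp Require Import all_boot all_order all_algebra.
From mathcomp Require Import all_classical all_reals all_analysis.

Import Order.TTheory GRing.Theory Num.Theory.
Import numFieldNormedType.Exports.

Local Open Scope classical_set_scope.
Local Open Scope ring_scope.

Section OrbitsAndCocycles.
Set Implicit Arguments.
Unset Strict Implicit.
Context {R : realType} {T : circle R -> circle R}.
Implicit Types (p q x : circle R) (O P : set (circle R)).
Implicit Types (g h : circle R -> R -> R).

(** Any point of the orbit can replace its base point [q]: from [iter m T q], another [m * l - m]
    steps complete [m] full periods and lead back to [q]. *)
Lemma orbit_of_mem O p : periodic_orbit T O -> O p ->
  (exists2 l, (0 < l)%N & iter l T p = p) /\
  O = [set iter n T p | n in [set: nat]].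
Proof.
case=> q [[l l_gt0 Tlq] ->] [m _ <-].
have per k : iter (k * l) T q = q.
  by elim: k => [//|k IHk]; rewrite mulSn iterD IHk.
split.
  by exists l => //; rewrite -iterD addnC iterD Tlq.
apply/seteqP; split=> x [n _ <-]; last by exists (n + m)%N; rewrite ?iterD.
have le_m : (m <= m * l)%N by rewrite leq_pmulr.
exists (n + (m * l - m))%N => //.
by rewrite -iterD -addnA subnK // iterD per.
Qed.

Lemma periodic_orbit_iter O x n : periodic_orbit T O -> O x -> O (iter n T x).
Proof. by move=> /orbit_of_mem /[apply] -[_ ->]; exists n. Qed.

Lemma periodic_orbit_eq O1 O2 x : periodic_orbit T O1 -> periodic_orbit T O2 ->
  O1 x -> O2 x -> O1 = O2.
Proof. by move=> h1 h2 /(orbit_of_mem h1)[_ ->] /(orbit_of_mem h2)[_ ->]. Qed.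

Lemma periodic_orbit_least_period O p : periodic_orbit T O -> O p ->
  exists l, is_least_period T p l.
Proof.
move=> /orbit_of_mem /[apply] -[[l l_gt0 Tlp] _].
have exl : exists k, (0 < k)%N && (iter k T p == p).
  by exists l; rewrite l_gt0 Tlp eqxx.
case: (ex_minnP exl) => k /andP[k_gt0 /eqP Tkp] kmin.
exists k; split=> // m /andP[m_gt0 lt_mk] Tmp.
by have := kmin m; rewrite m_gt0 Tmp eqxx leqNgt lt_mk => /(_ isT).
Qed.

(** [T] need not be injective, but on a periodic orbit [a * l - a] further steps undo [iter a T]. *)
Lemma periodic_orbit_cancel_iter O p a d : periodic_orbit T O -> O p ->
  iter (d + a) T p = iter a T p -> iter d T p = p.
Proof.
move=> hO Op; have [[l l_gt0 Tlp] _] := orbit_of_mem hO Op.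
have per k : iter (k * l) T p = p.
  by elim: k => [//|k IHk]; rewrite mulSn iterD IHk.
have le_a : (a <= a * l)%N by rewrite leq_pmulr.
move=> /(congr1 (iter (a * l - a) T)).
by rewrite -!iterD addnCA subnK // iterD !per.
Qed.

Lemma preorbit_stepE P x : (forall z, P z -> P (T z)) ->
  preorbit T P (T x) <-> preorbit T P x.
Proof.
move=> PT; split=> -[n Pn]; first by exists n.+1; rewrite iterSr.
by exists n; rewrite -iterSr /=; exact: PT.
Qed.

Lemma fwd_cocycleD g m n x t :
  fwd_cocycle T g (m + n) x t
  = fwd_cocycle T g m (iter n T x) (fwd_cocycle T g n x t).
Proof. by elim: m => [//|m IHm]; rewrite addSn /= IHm iterD. Qed.

Lemma bwd_cocycleK g h n x : (forall y, cancel (h y) (g y)) ->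
  cancel (bwd_cocycle T h n x) (fwd_cocycle T g n x).
Proof. by move=> hK; elim: n => [//|n IHn] t /=; rewrite IHn hK. Qed.

Lemma fwd_cocycle_inj g n x : (forall y, injective (g y)) ->
  injective (fwd_cocycle T g n x).
Proof. by move=> gI; elim: n => [//|n IHn] s t /= /gI /IHn. Qed.

(** Minimality of [l] forces [l <= d] unless [d = 0], so strong induction strips off one least
    period at a time, each acting as the identity on the fibre. *)
Lemma fwd_cocycle_return g p l d t :
  is_least_period T p l -> (forall s, fwd_cocycle T g l p s = s) ->
  iter d T p = p -> fwd_cocycle T g d p t = t.
Proof.
move=> [l_gt0 Tlp lmin] gl; elim/ltn_ind: d => -[//|d] IHd Tdp.
have le_ld : (l <= d.+1)%N.
  by rewrite leqNgt; apply/negP => lt_dl; exact: (lmin d.+1).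
have eq_d : (d.+1 - l + l)%N = d.+1 by rewrite subnK.
rewrite -eq_d fwd_cocycleD Tlp gl IHd //.
  by rewrite ltn_subrL l_gt0.
by move: Tdp; rewrite -{1}eq_d iterD Tlp.
Qed.

End OrbitsAndCocycles.

Theorem corollary2 (R : realType) (T : circle R -> circle R)
    (hT : markov_map T)
    (rho : nat) (Porb : 'I_rho -> set (circle R))
    (hper : forall r, periodic_orbit T (Porb r))
    (hdist : injective Porb)
    (alpha C : R) (halpha : 0 < alpha) (hC : 1 <= C)
    (g h : circle R -> R -> R)
    (hS : class_S T (\bigcup_(r in [set: 'I_rho]) Porb r) alpha C g h)
    (u : circle R -> R)
    (hubd : exists M : R, forall x,
       ~ preorbit T (\bigcup_(r in [set: 'I_rho]) Porb r) x -> `|u x| <= M)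
    (huinv : invariant_graph_on T
       (~` preorbit T (\bigcup_(r in [set: 'I_rho]) Porb r)) g u)
    (p : 'I_rho -> circle R) (hp : forall r, Porb r (p r)) :
  exists us : 'rV[R]_rho -> circle R -> R,
    forall s : 'rV[R]_rho,
      [/\ invariant_graph_on T setT g (us s),
          forall r : 'I_rho, us s (p r) = s 0 r &
          forall x, ~ preorbit T (\bigcup_(r in [set: 'I_rho]) Porb r) x ->
            us s x = u x].
Proof.
set P := \bigcup_(r in _) _ in hS hubd huinv *.
have gK x : cancel (g x) (h x) by case: (class_S_homeo hS x).
have hK x : cancel (h x) (g x) by case: (class_S_homeo hS x).
have PT z : P z -> P (T z).
  by case=> r _ rz; exists r => //;
    exact: (@periodic_orbit_iter _ T _ _ 1 (hper r) rz).
(* A value carried along the orbit of [p r] depends only on the point reached: two arrival times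
   differ by a return time of [p r]. *)
have orbit_value r a b t : iter a T (p r) = iter b T (p r) ->
    fwd_cocycle T g a (p r) t = fwd_cocycle T g b (p r) t.
  wlog le_ab : a b / (a <= b)%N => [wl|] Tab.
    by have /orP[/wl->//|/wl->] := leq_total a b.
  have Tp : iter (b - a) T (p r) = p r.
    by apply: (periodic_orbit_cancel_iter (hper r) (hp r) (a := a));
       rewrite subnK.
  have [l pl] := periodic_orbit_least_period (hper r) (hp r).
  rewrite -(subnK le_ab) addnC fwd_cocycleD Tp.
  rewrite (fwd_cocycle_return _ pl _ Tp) // => s.
  by apply: (class_S_periodic hS) pl; exists r.
(* Neither [n] nor [m] has to be minimal, so a step of the skew product keeps [n] and merely raises
   [m] by one. *)
pose G (s : 'rV[R]_rho) x v := exists n m r, iter n T x = iter m T (p r) /\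
  fwd_cocycle T g n x v = fwd_cocycle T g m (p r) (s 0 r).
have G_uniq s x v v' : G s x v -> G s x v' -> v = v'.
  move=> [n [m [r [Tx gv]]]] [n' [m' [r' [Tx' gv']]]].
  (* Both witnesses are pushed forward to the common time [n' + n]. The point reached lies on both
     orbits, which forces [r = r']. *)
  have Tpp : iter (n' + m) T (p r) = iter (n + m') T (p r').
    by rewrite !iterD -Tx -Tx' -!iterD addnC.
  have rr' : r = r'.
    apply: hdist.
    apply: (@periodic_orbit_eq _ T _ _ (iter (n' + m) T (p r))) => //.
      exact: periodic_orbit_iter.
    by rewrite Tpp; exact: periodic_orbit_iter.
  subst r'; apply: (@fwd_cocycle_inj _ T g (n' + n) x) => [y|].
    exact: can_inj (gK y).
  rewrite fwd_cocycleD gv Tx -fwd_cocycleD (orbit_value _ _ _ _ Tpp).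
  by rewrite (addnC n') !fwd_cocycleD gv' Tx'.
have G_ex s x : preorbit T P x -> exists v, G s x v.
  case=> n [r _ rn]; have [_ Or] := orbit_of_mem (hper r) (hp r).
  move: rn; rewrite Or => -[m _ Tpx].
  exists (bwd_cocycle T h n x (fwd_cocycle T g m (p r) (s 0 r))), n, m, r.
  by rewrite (bwd_cocycleK _ _ hK).
have G_step s x v : G s x v -> G s (T x) (g x v).
  move=> [n [m [r [Tx gv]]]]; exists n, m.+1, r; split.
    by rewrite -iterSr /= Tx.
  (* The sum [n + 1] splits off the first fibre map; as [n.+1] the same cocycle splits off the last
     one, where [Tx] and [gv] apply. *)
  have -> : fwd_cocycle T g n (T x) (g x v) = fwd_cocycle T g (n + 1) x v.
    by rewrite fwd_cocycleD.
  by rewrite addn1 /= Tx gv.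
(* The default [0] is never taken, since [G_ex] makes [G s x] nonempty on the preorbit. *)
pose us s x := if `[< preorbit T P x >] then xget 0 (G s x) else u x.
have usG s x : preorbit T P x -> G s x (us s x).
  by move=> Px; rewrite /us asboolT //; have [v Gv] := G_ex s x Px;
    exact: xgetI Gv.
exists us => s; split.
(* On the preorbit both sides satisfy [G s (T x)], hence agree; off it, [T x] is off it too and the
   invariance of [u] applies. *)
- move=> x _; have [Px|nPx] := pselect (preorbit T P x).
    by apply: (@G_uniq s (T x)); [exact/usG/(preorbit_stepE x PT)|
      exact/G_step/usG].
  by rewrite /us !asboolF ?huinv //; apply: contra_not nPx
    => /(preorbit_stepE x PT).
- move=> r; apply: (G_uniq s (p r)); first by apply: usG; exists 0%N; exists r.
  by exists 0%N, 0%N, r.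
- by move=> x nPx; rewrite /us asboolF.
Qed.
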